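(* Let $r,t$ be integers with $r\geq 3$ and $t$ even. Then $$\operatorname{gr}_4(P_5:S_t^r)= \begin{cases} \frac{3t-4}{2}, & \text{if } 3\leq r\leq \left\lfloor\frac{t}{4}\right\rfloor;\\ t+2r-2, & \text{if } \left\lceil\frac{t}{4}\right\rceil\leq r\leq \frac{t-2}{2}. \end{cases}$$
   Context: All graphs are finite, simple and undirected. $K_n$ is the complete graph on $n$ vertices and $P_5$ is the path with $5$ vertices and $4$ edges. $S_t^r$ is the graph of order $t$ obtained from the star $K_{1,t-1}$ by adding $r$ pairwise independent edges between the leaves, so that it has $r$ triangles (sharing the center) and $t-2r-1$ pendent edges. A $k$-edge-coloring assigns to each edge one of $k$ colors; all $k$-edge-colorings are assumed exact, i.e. each of the $k$ colors is used at least once. An edge-colored graph is rainbow if all its edges have different colors and monochromatic if all its edges have a single color. A copy of a graph means a (not necessarily induced) subgraph isomorphic to it. For non-empty graphs $G,H$ (graphs with at least one edge) and a positive integer $k$, the Gallai-Ramsey number $\operatorname{gr}_k(G:H)$ is the minimum integer $N$ with $\binom{N}{2}\geq k$ (so that $K_N$ admits a $k$-edge-coloring) such that for all $n\geq N$, every $k$-edge-coloring of $K_n$ contains either a rainbow copy of $G$ or a monochromatic copy of $H$. *)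

(* Defs.v *)
From mathcomp Require Import all_boot.
Set Implicit Arguments.
Unset Strict Implicit.
Unset Printing Implicit Defensive.

Record sgraph := SGraph {
  vertex :> finType;
  adj : rel vertex;
  adj_sym : symmetric adj;
  adj_irr : irreflexive adj
}.

Definition edges (G : sgraph) : {set {set G}} :=
  [set [set p.1; p.2] | p : G * G & adj p.1 p.2].

Section Families.
Variable n : nat.

Definition complete_adj : rel 'I_n := fun x y => x != y.

Fact complete_sym : symmetric complete_adj.
Proof. by move=> x y; rewrite /complete_adj eq_sym. Qed.

Fact complete_irr : irreflexive complete_adj.
Proof. by move=> x; rewrite /complete_adj eqxx. Qed.

Definition complete : sgraph := SGraph complete_sym complete_irr.

Definition path_adj : rel 'I_n :=
  fun x y => (y == x.+1 :> nat) || (x == y.+1 :> nat).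

Fact path_sym : symmetric path_adj.
Proof. by move=> x y; rewrite /path_adj orbC. Qed.

Fact path_irr : irreflexive path_adj.
Proof. by move=> x; rewrite /path_adj orbb ltn_eqF. Qed.

Definition path_graph : sgraph := SGraph path_sym path_irr.

(* The graph S_n^r: the center is 0, the leaves are 1, ..., n - 1, and the
   r independent edges are {1, 2}, {3, 4}, ..., {2r - 1, 2r}. All of them fit
   among the leaves exactly when 2r <= n - 1. *)
Definition star_arc (r x y : nat) : bool :=
  (x == 0) && (0 < y) || [&& odd x, y == x.+1 & y <= 2 * r].

Definition star_adj (r : nat) : rel 'I_n :=
  fun x y => star_arc r x y || star_arc r y x.

Fact star_sym r : symmetric (star_adj r).
Proof. by move=> x y; rewrite /star_adj orbC. Qed.

Fact star_irr r : irreflexive (star_adj r).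
Proof.
move=> x; rewrite /star_adj orbb /star_arc (ltn_eqF (ltnSn x)) andbF orbF.
by case: (nat_of_ord x).
Qed.

Definition star_triangles (r : nat) : sgraph :=
  SGraph (star_sym r) (star_irr r).

End Families.

(* f is an embedding of G as a (not necessarily induced) subgraph of F. *)
Definition copy (G F : sgraph) (f : G -> F) : Prop :=
  injective f /\ forall x y, adj x y -> adj (f x) (f y).

(* An edge-coloring is a function on vertex sets of which only the values on
   edges are ever used. *)
Definition exact_coloring (k : nat) (F : sgraph) (c : {set F} -> 'I_k) : Prop :=
  forall i : 'I_k, exists2 e, e \in edges F & c e = i.

Definition rainbow_copy (k : nat) (F : sgraph) (c : {set F} -> 'I_k)
    (G : sgraph) : Prop :=
  exists2 f : G -> F, copy f &
    {in edges G &, injective (fun e : {set G} => c (f @: e))}.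

Definition mono_copy (k : nat) (F : sgraph) (c : {set F} -> 'I_k)
    (H : sgraph) : Prop :=
  exists2 f : H -> F, copy f &
    exists i : 'I_k, forall e, e \in edges H -> c (f @: e) = i.

Definition gallai_ramsey_bound (k : nat) (G H : sgraph) (N : nat) : Prop :=
  k <= 'C(N, 2) /\
  forall n, N <= n ->
  forall c : {set complete n} -> 'I_k, exact_coloring c ->
    rainbow_copy c G \/ mono_copy c H.

(* gr_k(G : H) = N *)
Definition is_gallai_ramsey (k : nat) (G H : sgraph) (N : nat) : Prop :=
  gallai_ramsey_bound k G H N /\
  forall M, gallai_ramsey_bound k G H M -> N <= M.

(* Main.v *)
Require Import Defs.
From mathcomp Require Import all_boot zify.

Set Implicit Arguments.
Unset Strict Implicit.
Unset Printing Implicit Defensive.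

(** Upper bound. Let [f] be a colouring without rainbow P5 that uses all four
colours. If every vertex sees at most two colours, then some colour [i] is seen
by all vertices, so the vertices fall into three classes such that edges between
classes have colour [i] and edges inside a class have colour [i] or the colour
of the class. Let [A], [B], [C] be the classes in decreasing order of size [a],
[b], [c], and let [t = 2s]. If [A] has a matching of [r - b] edges of colour
[i], edges between [A] and [B] extend it to one of [r] edges, which with a
centre in [C] gives the monochromatic star. Otherwise at most [2 (r - b - 1)]
vertices of [A] meet all its edges of colour [i], and the others span a
monochromatic clique of order at least [n - 2r + 2 >= t].

If some vertex sees three colours, then all edges outside some set of at most
four vertices have the same colour. Together with an edge of the fourth colour,
the edges at that vertex contain a rainbow star, paw or spider; in each case a
finite search on six or seven vertices shows that a suitable vertex spans a
monochromatic triangle with any two vertices outside the chosen set.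

Lower bound. Colour the edges between three classes with one colour and each
class with its own colour. Class sizes [s - 1, s - 1, s - 1], respectively
[2s - 1, r - 1, r - 1], avoid both subgraphs. *)

(** * Colourings without rainbow P5 *)

(* Partial colourings use the colours 0, 1, 2, 3 and have the value 4 on edges
   that are not coloured yet. *)
Definition set_edge (col : nat -> nat -> nat) i j h := fun x y =>
  if (x == i) && (y == j) || (x == j) && (y == i) then h else col x y.

Definition partial_coloring (es : seq (nat * nat * nat)) :=
  foldr (fun e col => set_edge col e.1.1 e.1.2 e.2) (fun _ _ => 4) es.

Fixpoint rainbow_walk n (col : nat -> nat -> nat) l x vs cs : bool :=
  if l is l'.+1 then
    has (fun y => rainbow_walk n col l' y (y :: vs) (col x y :: cs))
      [seq y <- iota 0 n | (y \notin vs) && (col x y \notin cs)]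
  else true.

(* The initial list [[:: 4]] of forbidden colours excludes uncoloured edges. *)
Definition rainbow_P5 n col : bool :=
  has (fun x => rainbow_walk n col 4 x [:: x] [:: 4]) (iota 0 n).

Definition mono_triangle (col : nat -> nat -> nat) x y z :=
  [&& col x y < 4, col x y == col x z & col x y == col y z].

(* Colours the edges of [es] one after the other on the vertices 0, ..., k + 2,
   and succeeds if each branch reaches a rainbow P5 or makes the last three
   vertices a monochromatic triangle. The conditionals cannot be replaced by
   disjunctions, both sides of which [vm_compute] would evaluate. *)
Fixpoint search k (es : seq (nat * nat)) col : bool :=
  if mono_triangle col k k.+1 k.+2 then true
  else if es is (i, j) :: es' then
    all (fun h => let col' := set_edge col i j h in
           if rainbow_P5 k.+3 col' then true else search k es' col') (iota 0 4)
  else false.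

(* The orders of the edges were chosen to keep the search trees small. *)
Lemma search_paw : search 3
  [:: (3, 5); (3, 4); (1, 5); (2, 4); (4, 5); (0, 4); (0, 5); (2, 3); (1, 4);
      (2, 5); (1, 3)]
  (partial_coloring [:: (0, 1, 0); (0, 2, 1); (0, 3, 2); (1, 2, 3)]).
Proof. by vm_compute. Qed.

Lemma search_star : search 4
  [:: (2, 6); (4, 6); (3, 6); (5, 6); (4, 5); (1, 4); (3, 4); (2, 3); (0, 6);
      (3, 5); (2, 5); (1, 3); (2, 4); (1, 2); (1, 6); (1, 5); (0, 5)]
  (partial_coloring [:: (0, 1, 0); (0, 2, 1); (0, 3, 2); (0, 4, 3)]).
Proof. by vm_compute. Qed.

Lemma search_spider : search 4
  [:: (1, 3); (4, 5); (2, 4); (2, 6); (5, 6); (4, 6); (2, 5); (1, 5); (3, 6);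
      (1, 2); (3, 5); (0, 5); (1, 6); (0, 6); (3, 4); (2, 3)]
  (partial_coloring
     [:: (0, 1, 0); (0, 2, 1); (0, 3, 2); (0, 4, 0); (1, 4, 3)]).
Proof. by vm_compute. Qed.

(** * Soundness of the search *)

Section SearchSound.
Variables (n : nat) (phi : nat -> nat -> nat).
Hypothesis phi_free : forall i q,
  size q = 4 -> uniq (i :: q) -> all (gtn n) (i :: q) -> ~~ uniq (pairmap phi i q).

Let agrees (col : nat -> nat -> nat) :=
  forall i j, col i j = 4 \/ col i j = phi i j.

(** As 4 is forbidden, the walk uses coloured edges only, and these have their [phi] colours. *)
Lemma rainbow_walkP col l x vs cs :
    agrees col -> 4 \in cs -> rainbow_walk n col l x vs cs ->
  exists2 q, [/\ size q = l, uniq q, all (gtn n) q & ~~ has (mem vs) q] &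
    uniq (pairmap phi x q) && ~~ has (mem cs) (pairmap phi x q).
Proof.
move=> col_phi; elim: l x vs cs => [|l IHl] x vs cs cs4 /=; first by exists [::].
case/hasP=> y; rewrite mem_filter mem_iota /= add0n.
case/andP=> /andP[vs'y cs'xy] lt_y /IHl[|q [sz_q Uq lt_q vs'q] /andP[Uphi cs'phi]].
  by rewrite inE cs4 orbT.
have ephi: col x y = phi x y by case: (col_phi x y) cs'xy => // ->; rewrite cs4.
rewrite ephi in cs'xy cs'phi.
have split_has (T : eqType) (z : T) s s' :
    ~~ has (mem (z :: s)) s' -> (z \notin s') && ~~ has (mem s) s'.
  by rewrite has_sym /= negb_or [has _ s]has_sym.
case/split_has/andP: vs'q => q'y vs'q.
case/split_has/andP: cs'phi => phi'xy cs'phi.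
exists (y :: q) => /=.
  by rewrite sz_q q'y Uq lt_y negb_or vs'q vs'y.
by rewrite phi'xy Uphi negb_or cs'phi cs'xy.
Qed.

Lemma rainbow_P5_sound col : agrees col -> ~~ rainbow_P5 n col.
Proof.
move=> col_phi; apply/hasPn=> x; rewrite mem_iota add0n => lt_x.
apply/negP=> /(rainbow_walkP col_phi (mem_head _ _))[q [sz_q Uq lt_q x'q]].
case/andP=> Uphi _; have q'x: x \notin q.
  by rewrite has_sym /= orbF in x'q.
by move: (@phi_free x q sz_q); rewrite /= q'x Uq lt_q Uphi !andbT => /(_ isT lt_x).
Qed.

End SearchSound.

(** The total colouring [phi] follows one branch of the search tree. A rainbow P5 cannot end this
    branch, so the monochromatic triangle does. *)
Lemma search_sound k es col phi :
    (forall i j, phi i j = phi j i) -> (forall i j, phi i j < 4) ->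
    (forall i q, size q = 4 -> uniq (i :: q) -> all (gtn k.+3) (i :: q) ->
       ~~ uniq (pairmap phi i q)) ->
    (forall i j, col i j = 4 \/ col i j = phi i j) -> search k es col ->
  phi k k.+1 = phi k k.+2 /\ phi k k.+1 = phi k.+1 k.+2.
Proof.
move=> phiC phi_lt4 phi_free.
elim: es col => [|[i j] es IHes] col col_phi; rewrite /search -/search.
all: case: ifP => [/and3P[lt4 /eqP e1 /eqP e2] _|_].
- by move: (col_phi k k.+1) (col_phi k k.+2) (col_phi k.+1 k.+2); lia.
- by [].
- by move: (col_phi k k.+1) (col_phi k k.+2) (col_phi k.+1 k.+2); lia.
have agr h : h = phi i j ->
    forall x y, set_edge col i j h x y = 4 \/ set_edge col i j h x y = phi x y.
  move=> -> x y; rewrite /set_edge; case: ifP => [|_]; last exact: col_phi.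
  by case/orP=> /andP[/eqP-> /eqP->]; right.
move/allP/(_ (phi i j)); rewrite mem_iota phi_lt4 => /(_ isT).
rewrite (negPf (rainbow_P5_sound phi_free (agr _ erefl))).
exact/IHes/agr.
Qed.

Ltac split_neqs := repeat match goal with
  | |- is_true (_ && _) -> _ => case/andP
  | |- is_true true -> _ => move=> _
  | |- is_true _ -> _ => let H := fresh "neq" in move=> H
  end.

Ltac neqs := rewrite /= ?inE ?negb_or; split_neqs;
  repeat (apply/andP; split); solve [done | rewrite eq_sym; done].

(** * A vertex that sees three colours *)

Section Structure.
Variables (V : finType) (f : V -> V -> 'I_4).
Hypothesis fC : forall x y, f x y = f y x.
Hypothesis P5free : forall x q,
  size q = 4 -> uniq (x :: q) -> ~~ uniq (pairmap f x q).

(** Vertices are numbered by position in [vs ++ [:: x; y; z]], colours by position in [ks]. The four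
    distinct entries of [ks] exhaust the colours, so equal numbers mean equal colours. *)
Lemma search_mono_triangle k es pre vs ks x y z :
    size vs = k -> uniq (vs ++ [:: x; y; z]) -> uniq ks -> size ks = 4 ->
    (forall e, e \in pre -> e.2 < 4 /\
       f (nth x (vs ++ [:: x; y; z]) e.1.1) (nth x (vs ++ [:: x; y; z]) e.1.2)
       = nth ord0 ks e.2) ->
    search k es (partial_coloring pre) ->
  f x y = f x z /\ f x y = f y z.
Proof.
set ws := vs ++ _ => sz_vs Uws Uks sz_ks f_pre.
have in_ks h : h \in ks.
  suff: ks =i 'I_4 by move->.
  apply/subset_cardP; last exact/subset_predT.
  by rewrite (card_uniqP Uks) sz_ks card_ord.
have idx_inj : injective (index^~ ks).
  by move=> h1 h2 e; rewrite -(nth_index h1 (in_ks h1)) e nth_index.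
pose phi i j := index (f (nth x ws i) (nth x ws j)) ks.
have sz_ws : size ws = k.+3 by rewrite size_cat sz_vs /= addn3.
case/(@search_sound k es _ phi).
- by move=> i j; rewrite /phi fC.
- by move=> i j; rewrite -sz_ks index_mem.
- move=> i q sz_q Uq lt_q.
  suff ->: pairmap phi i q =
      [seq index h ks | h <- pairmap f (nth x ws i) (map (nth x ws) q)].
    rewrite map_inj_uniq //; apply: P5free; rewrite ?size_map //.
    rewrite -map_cons map_inj_in_uniq // => a b /(allP lt_q) la /(allP lt_q) lb.
    by move/eqP; rewrite nth_uniq ?sz_ws // => /eqP.
  by elim: q i {sz_q Uq lt_q} => //= j q IHq i; rewrite -IHq.
- elim: pre f_pre => [|e pre IHpre] f_pre i j /=; first by left.
  rewrite /set_edge; case: ifP => [|_]; last first.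
    by apply: IHpre => e' pre_e'; apply: f_pre; rewrite inE pre_e' orbT.
  have [lt4 fe] := f_pre e (mem_head _ _).
  by case/orP=> /andP[/eqP-> /eqP->]; right;
    rewrite /phi 1?[f (nth _ _ e.1.2) _]fC fe index_uniq ?sz_ks.
have nths i : nth x ws (k + i) = nth x [:: x; y; z] i.
  by rewrite nth_cat sz_vs ltnNge leq_addr addKn.
move: (nths 0) (nths 1) (nths 2); rewrite addn0 addn1 addn2 /phi => -> -> ->.
by move=> /idx_inj exz /idx_inj eyz.
Qed.

Definition mono_outside (S : {set V}) :=
  exists i, forall x y, x \notin S -> y \notin S -> x != y -> f x y = i.

(** All edges at [e] that avoid [S] share a colour, and any other edge avoiding [S] forms a triangle
    with [e]. *)
Lemma mono_outsideP e (S : {set V}) : e \notin S ->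
    (forall x y, x \notin S -> y \notin S -> uniq [:: e; x; y] ->
       f e x = f e y /\ f e x = f x y) ->
  mono_outside S.
Proof.
move=> S'e fS; case: (pickP [pred z | (z \notin S) && (z != e)]) => [z|S1].
  move=> /= /andP[S'z z'e]; exists (f e z).
  have fe y : y \notin S -> y != e -> f e y = f e z.
    move=> S'y y'e; have [-> //|y'z] := eqVneq y z.
    by case: (fS y z) => //=; rewrite !inE negb_or ![e == _]eq_sym y'e z'e y'z.
  move=> x y S'x S'y x'y; have [ex|x'e] := eqVneq x e.
    by rewrite ex fe // -ex eq_sym.
  have [ey|y'e] := eqVneq y e; first by rewrite ey fC fe.
  have [|_ <-] := fS x y S'x S'y; last exact: fe.
  by rewrite /= !inE negb_or ![e == _]eq_sym x'e y'e x'y.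
exists ord0 => x y S'x S'y; move: (S1 x) (S1 y) => /=.
by rewrite S'x S'y /= => /negbFE/eqP-> /negbFE/eqP->; rewrite eqxx.
Qed.

Lemma paw_mono_outside a b c d :
    uniq [:: a; b; c; d] -> uniq [:: f a b; f a c; f a d; f b c] ->
  mono_outside [set a; b; c].
Proof.
move=> Uv Uk; apply: (@mono_outsideP d).
  by move: Uv; neqs.
move=> x y S'x S'y Ud; pose vs := [:: a; b; c].
apply: (search_mono_triangle (vs := vs) _ _ Uk _ _ search_paw) => //.
  by move: Uv Ud S'x S'y; neqs.
by move=> e; rewrite !inE => /or4P[] /eqP->.
Qed.

Lemma star_mono_outside a b c d e :
    uniq [:: a; b; c; d; e] -> uniq [:: f a b; f a c; f a d; f a e] ->
  mono_outside [set a; b; c; d].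
Proof.
move=> Uv Uk; apply: (@mono_outsideP e); first by move: Uv; neqs.
move=> x y S'x S'y Ue; pose vs := [:: a; b; c; d].
apply: (search_mono_triangle (vs := vs) _ _ Uk _ _ search_star) => //.
  by move: Uv Ue S'x S'y; neqs.
by move=> g; rewrite !inE => /or4P[] /eqP->.
Qed.

Lemma spider_mono_outside a b c d e :
    uniq [:: a; b; c; d; e] -> uniq [:: f a b; f a c; f a d; f b e] ->
    f a e = f a b ->
  mono_outside [set a; b; c; d].
Proof.
move=> Uv Uk eab; apply: (@mono_outsideP e); first by move: Uv; neqs.
move=> x y S'x S'y Ue; pose vs := [:: a; b; c; d].
apply: (search_mono_triangle (vs := vs) _ _ Uk _ _ search_spider) => //.
  by move: Uv Ue S'x S'y; neqs.
by move=> g; rewrite !inE => /or4P[||| /orP[]] /eqP->.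
Qed.

Lemma cards4_le (a b c d : V) : #|[set a; b; c; d]| <= 4.
Proof.
by rewrite -!setUA !cardsU1 cards1; do 3!case: (_ \notin _).
Qed.

(** The edge [x y] has the fourth colour. If it meets [a], or if [a x] or [a y] has this colour too,
    there is a rainbow star at [a]. Otherwise the triangle [a x y] yields a spider if
    [f a x = f a y], and a paw if not. *)
Lemma three_colors_mono_outside a b c d x y :
    uniq [:: a; b; c; d] -> uniq [:: f a b; f a c; f a d; f x y] -> x != y ->
  exists2 S : {set V}, #|S| <= 4 & mono_outside S.
Proof.
move=> Uv Uk x'y.
have fneq u v : f a u != f a v -> u != v by apply: contra_neq => ->.
have star z : z != a -> f a z = f x y ->
    exists2 S : {set V}, #|S| <= 4 & mono_outside S.
  move=> z'a fz; exists [set a; b; c; d]; first exact: cards4_le.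
  rewrite -fz in Uk; apply: (star_mono_outside (e := z)) => //.
  have [zb zc zd] : [/\ b != z, c != z & d != z].
    by split; apply: fneq; move: Uk; neqs.
  by move: Uv z'a zb zc zd; neqs.
have [xa|x'a] := eqVneq x a; first by apply: (star y); rewrite -?xa 1?eq_sym.
have [ya|y'a] := eqVneq y a; first by apply: (star x); rewrite // fC -ya.
have [fx|fx] := eqVneq (f a x) (f x y); first exact: (star x).
have [fy|fy] := eqVneq (f a y) (f x y); first exact: (star y).
have [fxy|fxy] := eqVneq (f a y) (f a x).
  (* Two of [b], [c], [d] supply the colours at [a] other than [f a x]. *)
  have [u [v [u'a v'a Ukuv]]] : exists u v, [/\ u != a, v != a &
      uniq [:: f a x; f a u; f a v; f x y]].
    have [fb|fb] := eqVneq (f a b) (f a x).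
      by exists c, d; split; [move: Uv | move: Uv | rewrite -fb; move: Uk]; neqs.
    have [fc|fc] := eqVneq (f a c) (f a x).
      by exists b, d; split; [move: Uv | move: Uv | rewrite -fc; move: Uk]; neqs.
    by exists b, c; split; [move: Uv | move: Uv | move: Uk fb fc fx]; neqs.
  exists [set a; x; u; v]; first exact: cards4_le.
  apply: (spider_mono_outside (e := y)) => //.
  have [xu xv uv] : [/\ x != u, x != v & u != v].
    by split; apply: fneq; move: Ukuv; neqs.
  have [yu yv] : [/\ y != u & y != v].
    by split; apply: fneq; rewrite fxy; move: Ukuv; neqs.
  by move: x'a y'a u'a v'a xu xv uv yu yv x'y; neqs.
have [u [u'a Uku]] : exists u, u != a /\ uniq [:: f a x; f a y; f a u; f x y].
  have [fb|fb] := boolP (f a b \in [:: f a x; f a y]); last first.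
    by exists b; split; [move: Uv | move: Uk fxy fx fy fb]; neqs.
  have [fc|fc] := boolP (f a c \in [:: f a x; f a y]); last first.
    by exists c; split; [move: Uv | move: Uk fxy fx fy fc]; neqs.
  exists d; split; first by move: Uv; neqs.
  move: fb fc Uk; rewrite !inE => /orP[]/eqP-> /orP[]/eqP-> /=; rewrite ?inE ?eqxx //;
    move: fxy fx fy; neqs.
exists [set a; x; y].
  by rewrite -setUA !cardsU1 cards1; do 2!case: (_ \notin _).
apply: (paw_mono_outside (d := u)) => //.
have [xu yu] : [/\ x != u & y != u].
  by split; apply: fneq; move: Uku; neqs.
by move: x'a y'a u'a xu yu x'y; neqs.
Qed.

End Structure.

(** * Vertices that see at most two colours *)

Section Dominant.
Variables (V : finType) (f : V -> V -> 'I_4).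
Hypothesis fC : forall x y, f x y = f y x.

(** [p x] names the class of [x] by the colour that edges inside the class may have besides [i];
    between classes only [i] is left. *)
Definition dominant (i : 'I_4) (p : V -> 'I_4) :=
  (forall x, p x != i) /\
  (forall x y, x != y -> f x y = i \/ f x y = p x /\ p x = p y).

(* The sets of colours seen by the vertices have at most two elements and
   meet pairwise; since four colours occur they are not contained in a
   triangle, so they have a common colour. *)
Lemma two_colors_dominant :
    (forall a b c d, uniq [:: a; b; c; d] -> ~~ uniq [:: f a b; f a c; f a d]) ->
    (forall h, exists x y, x != y /\ f x y = h) ->
  exists i p, dominant i p.
Proof.
move=> f2 f_onto; pose C x := [set f x y | y in [set~ x]].
have inC x y : x != y -> f x y \in C x.
  by move=> x'y; apply: imset_f; rewrite !inE eq_sym.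
have C2 x u v w : u \in C x -> v \in C x -> u != v -> w \in C x ->
    (w == u) || (w == v).
  case/imsetP=> b; rewrite !inE => b'x -> /imsetP[c]; rewrite !inE => c'x -> u'v.
  case/imsetP=> d; rewrite !inE => d'x ->.
  have fneq y z : f x y != f x z -> y != z by apply: contra_neq => ->.
  have b'c := fneq _ _ u'v; apply: contraT; rewrite negb_or => /andP[w'u w'v].
  have d'b := fneq _ _ w'u; have d'c := fneq _ _ w'v.
  have /f2: uniq [:: x; b; c; d] by move: b'x c'x d'x b'c d'b d'c; neqs.
  by case/negP; move: u'v w'u w'v; neqs.
have [i Ci]: exists i, forall x, i \in C x.
  suff /existsP[i /forallP Ci] : [exists i, forall x, i \in C x] by exists i.
  apply: contraT; rewrite negb_exists => /forallP noC.
  have{noC} C' h : exists x, h \notin C x.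
    by have := noC h; rewrite negb_forall => /existsP[x C'x]; exists x.
  (* The vertices [x0], [y], [z] will see exactly the colours {i, j}, {j, k}, {i, k}. Any edge can
     serve as [x0 x1]; [ord0] merely provides one. *)
  have [x0 [x1 [x0'x1 _]]] := f_onto ord0.
  have [y y'i] := C' (f x0 x1); set i := f x0 x1 in y'i.
  have Ci : i \in C x0 by apply: inC.
  have x0'y : x0 != y by apply: contraNneq y'i => <-.
  have Cj : f x0 y \in C x0 by apply: inC.
  have Cj' : f x0 y \in C y by rewrite fC inC // eq_sym.
  have j'i : f x0 y != i by apply: contraNneq y'i => <-.
  have [z z'j] := C' (f x0 y); set j := f x0 y in Cj Cj' j'i z'j.
  have x0'z : x0 != z by apply: contraNneq z'j => <-.
  have y'z : y != z by apply: contraNneq z'j => <-.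
  have Ck : f y z \in C y by apply: inC.
  have Ck' : f y z \in C z by rewrite fC inC // eq_sym.
  have Ci' : i \in C z.
    have := C2 _ _ _ (f x0 z) Ci Cj; rewrite eq_sym inC // => /(_ j'i isT).
    have : f x0 z \in C z by rewrite fC inC // eq_sym.
    by move=> Cz /orP[]/eqP e; rewrite e // (negPf z'j) in Cz.
  have k'i : f y z != i by apply: contraNneq y'i => <-.
  have k'j : f y z != j by apply: contraNneq z'j => <-.
  set k := f y z in Ck Ck' k'i k'j.
  have [l [l'i l'j l'k]] : exists l, [/\ l != i, l != j & l != k].
    have : 0 < #|~: [set i; j; k]|.
      rewrite -(ltn_add2l #|[set i; j; k]|) addn0 cardsC card_ord -setUA.
      by rewrite !cardsU1 cards1; do 2!case: (_ \notin _).
    case/card_gt0P=> l; rewrite !inE !negb_or => /andP[/andP[li lj] lk].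
    by exists l.
  (* Besides [l], the vertex [w] sees only one further colour, which would have to lie in all three
     pairs. *)
  have [w [w' [ww' fl]]] := f_onto l.
  have Cl : l \in C w by rewrite -fl inC.
  have wneq x u v : u \in C x -> v \in C x -> u != v -> l != u -> l != v ->
      (w != x) && ((f w x == u) || (f w x == v)).
    move=> Cu Cv u'v l'u l'v; apply/andP; split.
      apply: contraTneq Cl => ->; apply/negP=> /(C2 _ _ _ _ Cu Cv u'v).
      by rewrite (negPf l'u) (negPf l'v).
    rewrite fC (C2 x) //; apply: inC; apply: contraTneq Cl => <-.
    by apply/negP=> /(C2 _ _ _ _ Cu Cv u'v); rewrite (negPf l'u) (negPf l'v).
  have /andP[w'x0 wx0] := wneq _ _ _ Cj Ci j'i l'j l'i.
  have /andP[w'y wy] := wneq _ _ _ Ck Cj' k'j l'k l'j.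
  have /andP[w'z wz] := wneq _ _ _ Ck' Ci' k'i l'k l'i.
  have eqw x u v : w != x -> (f w x == u) || (f w x == v) -> l != u -> l != v ->
      f w x = f w x0.
    move=> w'x fx l'u l'v; have l'w : l != f w x0.
      by case/orP: wx0 => /eqP->.
    apply/eqP; have := C2 _ _ _ _ Cl (inC _ _ w'x0) l'w (inC _ _ w'x).
    by case/orP=> // /eqP fxl; rewrite fxl (negPf l'u) (negPf l'v) in fx.
  have ey := eqw _ _ _ w'y wy l'k l'j; have ez := eqw _ _ _ w'z wz l'k l'i.
  move: wy wz; rewrite ey ez; case/orP: wx0 => /eqP->.
    by rewrite [j == k]eq_sym (negPf j'i) (negPf k'j).
  by rewrite ![i == _]eq_sym (negPf j'i) (negPf k'i).
(* A vertex that sees only [i] gets an arbitrary colour other than [i]. *)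
pose p x := odflt (if i == ord0 then ord_max else ord0) [pick h in C x | h != i].
exists i, p; split=> [x|x y x'y].
  rewrite /p; case: pickP => [h /andP[]|_] //=.
  by case: ifP => [/eqP->|/negbT]; rewrite // eq_sym.
have pE z w : z != w -> f z w != i -> f z w = p z.
  move=> z'w fzw; rewrite /p; case: pickP => [h /andP[Ch h'i]|/(_ (f z w))] /=.
    have := C2 z _ _ _ (Ci z) Ch _ (inC _ _ z'w).
    by rewrite eq_sym h'i (negPf fzw) => /(_ isT)/eqP.
  by rewrite inC // fzw.
have [->|fxy] := eqVneq (f x y) i; [by left | right].
split; first exact: pE.
by rewrite -(pE x y) // fC; apply: pE; [rewrite eq_sym | rewrite fC].
Qed.

End Dominant.

(** * Monochromatic stars with triangles *)

Section MonoStar.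
Variables (V : finType) (f : V -> V -> 'I_4).

(** The triangles of the star pair consecutive leaves, so the two ends of each matching edge are
    placed next to each other. *)
Fixpoint interleave (T : Type) (xs ys : seq T) : seq T :=
  match xs, ys with
  | x :: xs', y :: ys' => [:: x, y & interleave xs' ys']
  | _, _ => [::]
  end.

Lemma perm_interleave (T : eqType) (xs ys : seq T) :
  size xs = size ys -> perm_eq (interleave xs ys) (xs ++ ys).
Proof.
elim: xs ys => [|x xs IHxs] [|y ys] //= [/IHxs pxy].
by rewrite perm_cons perm_sym -[y :: ys]cat1s perm_catCA /= perm_cons perm_sym.
Qed.

Lemma nth_interleave (T : Type) (x0 : T) (xs ys : seq T) m :
    size xs = size ys ->
  nth x0 (interleave xs ys) m.*2 = nth x0 xs m /\
  nth x0 (interleave xs ys) m.*2.+1 = nth x0 ys m.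
Proof.
elim: xs ys m => [|x xs IHxs] [|y ys] [|m] //= [/IHxs e].
exact: e.
Qed.

(** The centre is [x], and [s] lists the leaves from leaf 1 on, so leaf numbers exceed positions in
    [s] by one. *)
Definition mono_star t r :=
  exists i x s, [/\ size s = t.-1, uniq (x :: s), {in s, forall y, f x y = i}
    & forall m, m < r -> f (nth x s m.*2) (nth x s m.*2.+1) = i].

Lemma mono_star_matching t r i x (N : {set V}) xs ys :
    size xs = r -> uniq (xs ++ ys) -> {subset xs ++ ys <= N} ->
    all2 (fun y z => f y z == i) xs ys ->
    x \notin N -> {in N, forall y, f x y = i} -> r.*2 <= t.-1 <= #|N| ->
  mono_star t r.
Proof.
move=> sz_xs Uxy sub_xyN; rewrite all2E => /andP[/eqP sz_ys xy_i] N'x Nx.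
case/andP=> le_rt le_tN; have pxy := perm_interleave sz_ys.
(* The matching comes first and the rest of [N] follows; cutting at [t.-1 >= r.*2] leaves the
   matching intact. *)
pose s := interleave xs ys ++ [seq z <- enum N | z \notin xs ++ ys].
have sN : perm_eq s (enum N).
  apply: uniq_perm; rewrite ?enum_uniq //.
    rewrite cat_uniq (perm_uniq pxy) Uxy filter_uniq ?enum_uniq // andbT.
    by apply/hasPn=> z; rewrite mem_filter (perm_mem pxy) => /andP[].
  move=> z; rewrite mem_cat mem_filter (perm_mem pxy) mem_enum.
  by case: (boolP (z \in xs ++ ys)) => // /sub_xyN ->.
have sz_s : size s = #|N| by rewrite (perm_size sN) -cardE.
exists i, x, (take t.-1 s); split.
- by rewrite size_takel ?sz_s.
- rewrite /= take_uniq ?(perm_uniq sN) ?enum_uniq // andbT.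
  by apply: contra N'x => /mem_take; rewrite (perm_mem sN) mem_enum.
- by move=> y /mem_take; rewrite (perm_mem sN) mem_enum; apply: Nx.
move=> m lt_mr; have sz_i : size (interleave xs ys) = r.*2.
  by rewrite (perm_size pxy) size_cat -sz_ys sz_xs addnn.
rewrite !nth_take ?nth_cat ?sz_i; try by move: lt_mr le_rt; lia.
have [-> ->] : (m.*2 < r.*2) = true /\ (m.*2.+1 < r.*2) = true.
  by move: lt_mr; lia.
have [-> ->] := nth_interleave x m sz_ys.
move/(all_nthP (x, x))/(_ m): xy_i.
by rewrite size_zip -sz_ys minnn sz_xs nth_zip //= => /(_ lt_mr)/eqP.
Qed.

Lemma mono_star_clique t r i (A : {set V}) :
    r.*2 < t -> t <= #|A| -> {in A &, forall x y, x != y -> f x y = i} ->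
  mono_star t r.
Proof.
move=> lt_rt le_tA Ai; case eA: (enum A) => [|x s].
  by move: lt_rt le_tA; rewrite cardE eA /=; lia.
have sz_s : #|A| = (size s).+1 by rewrite cardE eA.
have /andP[s'x Us] : uniq (x :: s) by rewrite -eA enum_uniq.
have Ax : x \in A by rewrite -mem_enum eA mem_head.
have sA : {subset s <= A :\ x}.
  move=> y sy; rewrite !inE -(mem_enum A) eA inE sy orbT andbT.
  by apply: contraNneq s'x => <-.
have s_split : take r s ++ take r (drop r s) = take r.*2 s.
  by rewrite -addnn takeD.
have Uxy : uniq (take r.*2 s) by rewrite take_uniq.
have sz_x : size (take r s) = r by rewrite size_takel //; lia.
apply: (@mono_star_matching t r i x (A :\ x) (take r s) (take r (drop r s))).
- by [].
- by rewrite s_split.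
- by rewrite s_split => y /mem_take /sA.
- have sz_y : size (take r s) = size (take r (drop r s)).
    by rewrite sz_x size_takel // size_drop; lia.
  rewrite all2E sz_y eqxx; apply/allP=> -[y z] yz /=.
  have sy : y \in take r s.
    by rewrite -(unzip1_zip (eq_leq sz_y)); apply: (map_f fst yz).
  have sz : z \in take r (drop r s).
    by rewrite -(unzip2_zip (eq_leq (esym sz_y))); apply: (map_f snd yz).
  have /setD1P[_ Ay] := sA y (mem_take sy).
  have /setD1P[_ Az] := sA z (mem_drop (mem_take sz)).
  apply/eqP/Ai => //; apply: contraTneq sz => <-; apply/negP=> sz.
  by move: Uxy; rewrite -s_split cat_uniq => /and3P[_ /hasPn/(_ y sz)/negP].
- by rewrite !inE eqxx.
- by move=> y; rewrite !inE eq_sym => /andP[xy Ay]; apply: Ai.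
by have := cardsD1 x A; rewrite Ax; lia.
Qed.

(* A maximal matching in colour [i], or its set of endpoints. *)
Lemma matching_or_cover (A : {set V}) i m :
  (exists xs ys, [/\ size xs = m, uniq (xs ++ ys), {subset xs ++ ys <= A} &
     all2 (fun y z => f y z == i) xs ys]) \/
  (exists2 T : {set V}, #|T|.+2 <= m.*2 &
     {in A :\: T &, forall x y, x != y -> f x y != i}).
Proof.
elim: m => [|m [[xs [ys [sz_xs Uxy sA xy_i]]]|[T leT T'i]]]; first 1 last.
- pose T := [set x in xs ++ ys].
  case: (pickP [pred q : V * V | [&& q.1 \in A :\: T, q.2 \in A :\: T, q.1 != q.2
     & f q.1 q.2 == i]]) => [[x y]|noi].
    rewrite /= !inE => /and4P[/andP[T'x Ax] /andP[T'y Ay] x'y fxy].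
    have pxy : perm_eq ((x :: xs) ++ y :: ys) [:: x, y & xs ++ ys].
      by rewrite /= perm_cons -[y :: ys]cat1s perm_catCA.
    left; exists (x :: xs), (y :: ys); split.
    + by rewrite /= sz_xs.
    + by rewrite (perm_uniq pxy) /= !inE negb_or x'y T'x T'y Uxy.
    + move=> z; rewrite (perm_mem pxy) !inE => /or3P[/eqP-> | /eqP-> | /sA] //.
    + by rewrite /= fxy.
  right; exists T; last first.
    by move=> x y Ax Ay x'y; move: (noi (x, y)); rewrite /= Ax Ay x'y /= => ->.
  rewrite cardsE (card_uniqP Uxy) size_cat.
  by move: xy_i; rewrite all2E => /andP[/eqP <- _]; rewrite sz_xs; lia.
- by right; exists T => //; rewrite doubleS; lia.
by left; exists [::], [::].
Qed.

End MonoStar.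

(** * Three classes joined in one colour *)

Section ThreeParts.
Variables (V : finType) (f : V -> V -> 'I_4).
Hypothesis fC : forall x y, f x y = f y x.

Lemma three_parts_mono_star (A B C : {set V}) i j s r :
    [disjoint A & B] -> [disjoint A & C] -> [disjoint B & C] ->
    {in A & B, forall x y, f x y = i} -> {in A & C, forall x y, f x y = i} ->
    {in B & C, forall x y, f x y = i} ->
    {in A &, forall x y, x != y -> f x y = i \/ f x y = j} ->
    0 < #|C| <= #|B| -> #|B| <= #|A| -> r < s ->
    3 * s <= #|A| + #|B| + #|C| + 2 -> 2 * s + 2 * r <= #|A| + #|B| + #|C| + 2 ->
  mono_star f s.*2 r.
Proof.
move=> dAB dAC dBC fAB fAC fBC fA /andP[/card_gt0P[v Cv] leCB] leBA lt_rs n1 n2.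
(* The subtraction is truncated: if [B] has at least [r] vertices, the matching inside [A] is empty.
   Below, [l] is the minimum of [r] and [#|B|]. *)
case: (matching_or_cover f A i (r - #|B|)) => [|[T leT T'i]].
  move=> [xs [ys [sz_xs Uxy sA xy_i]]]; pose l := r - (r - #|B|).
  have sz_ys : size ys = r - #|B|.
    by rewrite -sz_xs; move: xy_i; rewrite all2E => /andP[/eqP].
  pose T := [set x in xs ++ ys]; pose us := take l (enum (A :\: T)).
  pose ws := take l (enum B).
  have cT : #|T| = (r - #|B|).*2.
    by rewrite cardsE (card_uniqP Uxy) size_cat sz_xs sz_ys addnn.
  have cAT : #|A :\: T| = #|A| - (r - #|B|).*2.
    by rewrite cardsDS ?cT //; apply/subsetP=> x; rewrite inE => /sA.
  have sz_us : size us = l by rewrite size_takel // -cardE cAT /l; lia.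
  have sz_ws : size ws = l by rewrite size_takel // -cardE /l; lia.
  have us_A x : x \in us -> (x \in A) && (x \notin xs ++ ys).
    by move/mem_take; rewrite mem_enum !inE andbC.
  have ws_B x : x \in ws -> x \in B by move/mem_take; rewrite mem_enum.
  have A'B x : x \in A -> x \notin B by move=> Ax; rewrite (disjointFr dAB Ax).
  have pxy : perm_eq ((xs ++ us) ++ ys ++ ws) ((xs ++ ys) ++ us ++ ws).
    by rewrite -!catA perm_cat2l perm_catCA.
  apply: (@mono_star_matching _ _ _ _ i v (A :|: B) (xs ++ us) (ys ++ ws)).
  - by rewrite size_cat sz_xs sz_us /l; lia.
  - rewrite (perm_uniq pxy) cat_uniq Uxy cat_uniq !take_uniq ?enum_uniq //= andbT.
    apply/andP; split; apply/hasPn=> x.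
      rewrite mem_cat => /orP[/us_A/andP[] // | /ws_B Bx].
      by apply: contraL Bx => /sA/A'B.
    by move/ws_B=> Bx; apply: contraL Bx => /us_A/andP[/A'B].
  - move=> x; rewrite (perm_mem pxy) mem_cat inE => /orP[/sA-> //|].
    by rewrite mem_cat => /orP[/us_A/andP[->] // | /ws_B ->]; rewrite orbT.
  - rewrite all2E !size_cat sz_xs sz_ys sz_us sz_ws eqxx /= zip_cat ?sz_xs //.
    rewrite all_cat; move: xy_i; rewrite all2E => /andP[_ ->] /=.
    apply/allP=> -[x y] xy /=; apply/eqP/fAB.
      suff /us_A/andP[] : x \in us by [].
      by rewrite -(@unzip1_zip _ _ us ws) ?sz_us ?sz_ws //; apply: (map_f fst xy).
    apply: ws_B.
    by rewrite -(@unzip2_zip _ _ us ws) ?sz_us ?sz_ws //; apply: (map_f snd xy).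
  - by rewrite inE negb_or (disjointFl dAC Cv) (disjointFl dBC Cv).
  - by move=> y /setUP[Ay|By]; rewrite fC; [apply: fAC | apply: fBC].
  (* As [C] is the smallest class, [3 * s <= #|A| + #|B| + #|C| + 2] leaves at least [2 * s - 1]
     vertices in [A :|: B], one for each leaf. *)
  rewrite cardsU (disjoint_setI0 dAB) cards0 subn0; lia.
(* The term [2 * #|B|] in the bound on [T] pays for both [B] and [C], since [#|C| <= #|B|]. *)
apply: (@mono_star_clique _ _ _ _ j (A :\: T)); first by lia.
  have := cardsID T A; have := subset_leq_card (subsetIr A T); lia.
move=> x y ATx ATy x'y; have [/setDP[Ax _] /setDP[Ay _]] := (ATx, ATy).
by have [fxy|//] := fA x y Ax Ay x'y; case/eqP: (T'i x y ATx ATy x'y).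
Qed.

End ThreeParts.

Section FreeColoring.
Variables (V : finType) (f : V -> V -> 'I_4).
Hypothesis fC : forall x y, f x y = f y x.

Lemma dominant_mono_star i p s r :
    dominant f i p -> (forall h, h != i -> exists x, p x = h) -> r < s ->
    3 * s <= #|V| + 2 -> 2 * s + 2 * r <= #|V| + 2 ->
  mono_star f s.*2 r.
Proof.
move=> [p'i f_p] p_onto lt_rs n1 n2; pose cl h := [set x | p x == h].
pose ge_cl := relpre (fun h => #|cl h|) geq.
pose l := sort ge_cl (rem i (enum 'I_4)).
have Ul : uniq l by rewrite sort_uniq rem_uniq // enum_uniq.
have inl h : (h \in l) = (h != i).
  by rewrite mem_sort mem_rem_uniq ?enum_uniq // !inE mem_enum andbT.
have sz_l : size l = 3 by rewrite size_sort size_rem ?mem_enum // size_enum_ord.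
have: sorted ge_cl l by apply: sort_sorted => h1 h2; apply: leq_total.
move: l sz_l Ul inl => [|h1 [|h2 [|h3 [|//]]]] //= _.
rewrite !inE negb_or andbT => /andP[/andP[h12 h13] h23] inl /and3P[le21 le32 _].
have cl_f h k : h != k -> {in cl h & cl k, forall x y, f x y = i}.
  move=> h'k x y; rewrite !inE => /eqP px /eqP py.
  have pxy : p x != p y by rewrite px py.
  have x'y : x != y by apply: contraNneq pxy => ->.
  by case: (f_p x y x'y) => // -[_ e]; rewrite e eqxx in pxy.
have cl_disj h k : h != k -> [disjoint cl h & cl k].
  move=> h'k; rewrite -setI_eq0; apply/eqP/setP=> x; rewrite !inE.
  by apply: contraNF h'k => /andP[/eqP<- /eqP<-].
have cards : #|V| = #|cl h1| + #|cl h2| + #|cl h3|.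
  rewrite -cardsT -cardsUI (disjoint_setI0 (cl_disj _ _ h12)) cards0 addn0.
  rewrite -cardsUI setIUl !(disjoint_setI0 (cl_disj _ _ _)) // setU0 cards0 addn0.
  congr #|pred_of_set _|; apply/setP=> x; rewrite !inE -orbA; apply/esym.
  by have := inl (p x); rewrite p'i !inE.
apply: (@three_parts_mono_star _ _ fC (cl h1) (cl h2) (cl h3) i h1) => //;
  try exact: cl_disj; try exact: cl_f; rewrite -?cards //.
  move=> x y; rewrite !inE => /eqP px /eqP py x'y.
  by case: (f_p x y x'y) => [|[]]; [left | right; rewrite -px].
rewrite le32 andbT; have /p_onto[x px] : h3 != i by rewrite -inl !inE eqxx !orbT.
by apply/card_gt0P; exists x; rewrite inE px.
Qed.

Lemma free_coloring_mono_star s r :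
    (forall x q, size q = 4 -> uniq (x :: q) -> ~~ uniq (pairmap f x q)) ->
    (forall h, exists x y, x != y /\ f x y = h) -> 3 <= r < s ->
    3 * s <= #|V| + 2 -> 2 * s + 2 * r <= #|V| + 2 ->
  mono_star f s.*2 r.
Proof.
move=> P5free f_onto /andP[r3 lt_rs] n1 n2.
case: (boolP [exists q : V * V * V * V, uniq [:: q.1.1.1; q.1.1.2; q.1.2; q.2] &&
    uniq [:: f q.1.1.1 q.1.1.2; f q.1.1.1 q.1.2; f q.1.1.1 q.2]]).
  case/existsP=> -[[[a b] c] d] /= /andP[Uv Uk].
  have [h Ukh] : exists h, uniq [:: f a b; f a c; f a d; h].
    have : 0 < #|~: [set f a b; f a c; f a d]|.
      rewrite -(ltn_add2l #|[set f a b; f a c; f a d]|) addn0 cardsC card_ord.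
      by rewrite -setUA !cardsU1 cards1; do 2!case: (_ \notin _).
    case/card_gt0P=> h; rewrite !inE => h'; exists h; move: Uk h'; neqs.
  have [x [y [x'y fxy]]] := f_onto h; rewrite -fxy in Ukh.
  have [S leS [i Si]] := three_colors_mono_outside fC P5free Uv Ukh x'y.
  apply: (@mono_star_clique _ _ _ _ i (~: S)); first by lia.
    (* Here [3 <= r] enters: the order is at least [2 * s + 2 * r - 2 >= 2 * s + 4], so at least
       [2 * s] vertices remain outside [S]. *)
    by have := cardsC S; lia.
  by move=> u v; rewrite !inE; apply: Si.
rewrite negb_exists => /forallP no3.
have [|i [p ip]] := two_colors_dominant fC _ f_onto.
  move=> a b c d Uv; have := no3 (a, b, c, d).
  by rewrite negb_and /= => /orP[/negP[]|]//; apply: Uv.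
apply: (dominant_mono_star ip) => // h h'i; have [x [y [x'y fxy]]] := f_onto h.
exists x; have [_ f_p] := ip.
by case: (f_p x y x'y) => [e|[<- _]] //; rewrite -fxy e eqxx in h'i.
Qed.

End FreeColoring.

(** * Copies as lists of vertices *)

Lemma imset_pair (T U : finType) (g : T -> U) x y :
  g @: [set x; y] = [set g x; g y].
Proof. by rewrite imsetU1 imset_set1. Qed.

Lemma path_edgeP n e : e \in edges (path_graph n) ->
  exists k l : 'I_n, l = k.+1 :> nat /\ e = [set k; l].
Proof.
case/imsetP=> -[k l]; rewrite inE /= => /orP[]/eqP kl ->; first by exists k, l.
by exists l, k; rewrite setUC.
Qed.

Lemma star_edgeP t r e : e \in edges (star_triangles t r) ->
  exists k l : 'I_t, star_arc r k l /\ e = [set k; l].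
Proof.
case/imsetP=> -[k l]; rewrite inE /= => /orP[] kl ->; first by exists k, l.
by exists l, k; rewrite setUC.
Qed.

Section Copies.
Variables (n : nat) (c : {set complete n} -> 'I_4).
Let f (x y : complete n) := c [set x; y].

Lemma nth_copy (G : sgraph) k (v : G -> 'I_k) (s : seq (complete n)) x :
    injective v -> size s = k -> uniq s ->
  copy (fun y : G => nth x s (v y) : complete n).
Proof.
move=> v_inj sz_s Us; have g_inj : injective (fun y => nth x s (v y)).
  by move=> y z /eqP; rewrite nth_uniq ?sz_s // => /eqP/val_inj/v_inj.
split=> // y z yz; apply/eqP=> /g_inj eyz.
by rewrite eyz adj_irr in yz.
Qed.

Lemma rainbow_copy_path x q :
    size q = 4 -> uniq (x :: q) -> uniq (pairmap f x q) ->
  rainbow_copy c (path_graph 5).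
Proof.
move=> sz_q Uq Uf.
have sz_f : size (pairmap f x q) = 4 by rewrite size_pairmap.
exists (fun k : path_graph 5 => nth x (x :: q) (id k)).
  by apply: (@nth_copy (path_graph 5) 5 id); rewrite //= sz_q.
have cE (k l : 'I_5) : l = k.+1 :> nat ->
    c ((fun k : path_graph 5 => nth x (x :: q) (id k)) @: [set k; l]) =
    nth ord0 (pairmap f x q) k.
  move=> kl; have lt_k4 : k < 4 by rewrite -ltnS -kl.
  by rewrite imset_pair (nth_pairmap x) ?sz_q //= kl.
move=> _ _ /path_edgeP[k1 [l1 [kl1 ->]]] /path_edgeP[k2 [l2 [kl2 ->]]].
rewrite !cE // => /eqP; rewrite nth_uniq ?sz_f -1?ltnS -?kl1 -?kl2 //.
move/eqP/val_inj=> k12; rewrite k12; congr [set _; _]; apply/val_inj.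
by rewrite /= kl1 kl2 k12.
Qed.

Lemma rainbow_copy_pathP : rainbow_copy c (path_graph 5) ->
  exists g : 'I_5 -> complete n,
    uniq [seq f (g (inord k)) (g (inord k.+1)) | k <- iota 0 4].
Proof.
case=> g _ g_rb; exists g; rewrite map_inj_in_uniq ?iota_uniq // => k l.
rewrite !mem_iota !add0n /= => lt_k lt_l; rewrite /f -!(imset_pair g).
have edge m : m < 4 -> [set inord m; inord m.+1] \in edges (path_graph 5).
  move=> lt_m; apply/imsetP; exists (inord m, inord m.+1); rewrite // inE /=.
  by rewrite /path_adj !inordK ?eqxx // ltnW.
move=> e; have /setP ekl := g_rb _ _ (edge k lt_k) (edge l lt_l) e.
have := ekl (inord k); have := ekl (inord k.+1).
rewrite !inE !eqxx orbT /= -!val_eqE /= !inordK //; lia.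
Qed.

Lemma mono_copy_star t r : 0 < t -> mono_star f t r ->
  mono_copy c (star_triangles t r).
Proof.
move=> t_gt0 [i [x [s [sz_s Us fx fs]]]].
have sz_xs : size (x :: s) = t by rewrite /= sz_s prednK.
exists (fun k : star_triangles t r => nth x (x :: s) (id k)).
  exact: (@nth_copy (star_triangles t r) t id).
exists i => _ /star_edgeP[k [l [kl ->]]]; rewrite imset_pair.
case/orP: kl => [/andP[/eqP-> l_gt0] | /and3P[odd_k /eqP-> le_l]].
  by apply: fx; rewrite -[nat_of_ord l]prednK //= mem_nth // sz_s -ltnS !prednK.
(* The odd leaf [k] sits at position [m.*2] of [s], as position 0 of [x :: s] holds the centre. *)
have [m km] : exists m, k = m.*2.+1 :> nat by exists (k./2); lia.
rewrite /id km /=; apply: fs; lia.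
Qed.

End Copies.

(** * Colourings by classes *)

Section ClassColoring.
Variables (n : nat) (p : complete n -> 'I_4).
Hypothesis p_neq0 : forall x, p x != ord0.

(** Colour 0 names no class and is the default for sets that meet several classes. *)
Definition class_coloring (e : {set complete n}) : 'I_4 :=
  odflt ord0 [pick h | [forall x in e, p x == h]].

Lemma class_coloring2 x y :
  class_coloring [set x; y] = if p x == p y then p x else ord0.
Proof.
rewrite /class_coloring; case: pickP => [h /forall_inP hP|noh] /=.
  have [/eqP-> /eqP->] := (hP x (set21 x y), hP y (set22 x y)).
  by rewrite eqxx.
case: eqP => // pxy; have /forall_inP[] := negbT (noh (p x)).
by move=> z; rewrite !inE => /orP[]/eqP->; rewrite ?pxy.
Qed.

Lemma class_coloring_exact :
    (forall h, h != ord0 -> exists x y, [/\ x != y, p x = h & p y = h]) ->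
  exact_coloring class_coloring.
Proof.
move=> p2; have edge x y : x != y -> [set x; y] \in edges (complete n).
  by move=> x'y; apply/imsetP; exists (x, y); rewrite // inE.
move=> h; have [->|/p2[x [y [x'y px py]]]] := eqVneq h ord0; last first.
  by exists [set x; y]; rewrite ?edge // class_coloring2 px py eqxx.
have [x [_ [_ px _]]] := p2 ord_max isT.
have [|y [_ [_ py _]]] := p2 (inord 1); first by rewrite -val_eqE /= inordK.
have pxy : p x != p y by rewrite px py -val_eqE /= inordK.
exists [set x; y]; last by rewrite class_coloring2 (negPf pxy).
by apply: edge; apply: contraNneq pxy => ->.
Qed.

(* Two edges with a common end that have distinct colours cannot both lie
   inside classes, so two of the four edges of a path have colour 0. *)
Lemma class_coloring_no_rainbow :
  ~ rainbow_copy class_coloring (path_graph 5).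
Proof.
case/rainbow_copy_pathP=> g /=; pose f x y := class_coloring [set x; y].
have adj0 x y z : f x y != f y z -> (f x y == ord0) || (f y z == ord0).
  rewrite /f !class_coloring2; case: (p x =P p y) => [->|_]; last by rewrite eqxx.
  by case: (p y =P p z) => [->|_]; rewrite eqxx // orbT.
rewrite -!/(f _ _) !inE !negb_or !andbT.
case/and3P=> /and3P[n01 n02 n03] /andP[n12 n13] n23.
move: (adj0 _ _ _ n01) (adj0 _ _ _ n23) n02 n03 n12 n13.
by do 2![case/orP=> /eqP->]; rewrite eqxx.
Qed.

(** A copy in a nonzero colour lies in the class of its centre, which is too small. In colour 0 all
    leaves lie outside the class of the centre: either too few vertices remain there, or each of the
    [r] triangles meets all three classes and [k] would need [r] vertices. *)
Lemma class_coloring_no_mono t r :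
    0 < t -> r.*2 < t ->
    (forall h, #|[set x | p x == h]| < t) ->
    (forall h, h != ord0 -> #|[set x | p x != h]| < t.-1 \/
       exists k, [/\ k != h, k != ord0 & #|[set x | p x == k]| < r]) ->
  ~ mono_copy class_coloring (star_triangles t r).
Proof.
move=> t_gt0 lt_rt small deg [g [g_inj _] [i gi]].
pose z : star_triangles t r := Ordinal t_gt0.
have color x y : adj x y -> (if p (g x) == p (g y) then p (g x) else ord0) = i.
  move=> xy; rewrite -class_coloring2 -imset_pair; apply: gi.
  by apply/imsetP; exists (x, y); rewrite // inE.
have adjz x : x != z -> adj z x.
  move=> x'z; apply/orP; left; rewrite /star_arc /= lt0n; apply/orP; left.
  by apply: contraNneq x'z => x0; apply/eqP/val_inj.
have [i0|i'0] := eqVneq i ord0; last first.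
  have pz x : p (g x) = p (g z).
    have [-> //|/adjz/color] := eqVneq x z.
    by case: eqP => // _ i0; rewrite -i0 eqxx in i'0.
  have := small (p (g z)); rewrite ltnNge => /negP[].
  rewrite -[t]card_ord -(card_codom g_inj); apply/subset_leq_card/subsetP=> y.
  by case/codomP=> x ->; rewrite inE pz.
have neq x y : adj x y -> p (g x) != p (g y).
  move=> /color; rewrite i0; case: eqP => // _ e.
  by have := p_neq0 (g x); rewrite e eqxx.
have [|[k [k'z k'0 lt_k]]] := deg _ (p_neq0 (g z)).
  rewrite ltnNge => /negP[].
  have <-: #|[set~ z]| = t.-1 by rewrite cardsC1 card_ord.
  rewrite -(card_imset _ g_inj); apply/subset_leq_card/subsetP=> y.
  by case/imsetP=> x; rewrite !inE => /adjz/neq zx ->; rewrite eq_sym.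
pose odd_leaf (m : 'I_r) : star_triangles t r := insubd z m.*2.+1.
pose even_leaf (m : 'I_r) : star_triangles t r := insubd z m.*2.+2.
have leafE (m : 'I_r) : odd_leaf m = m.*2.+1 :> nat /\ even_leaf m = m.*2.+2 :> nat.
  have lt_t : m.*2.+2 < t by have := ltn_ord m; lia.
  by rewrite /odd_leaf /even_leaf !val_insubd lt_t (ltnW lt_t).
pose y m := if p (g (odd_leaf m)) == k then g (odd_leaf m) else g (even_leaf m).
have y_inj : injective y.
  move=> m1 m2; have [o1 e1] := leafE m1; have [o2 e2] := leafE m2.
  rewrite /y; do 2![case: ifP => _]; move/g_inj/(congr1 val) => /= e;
    apply/val_inj => /=; lia.
suff: r <= #|[set x | p x == k]| by rewrite leqNgt lt_k.
rewrite -[r in r <= _]card_ord -(card_codom y_inj).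
apply/subset_leq_card/subsetP=> _ /codomP[m ->].
rewrite inE /y; case: ifP => // odd'k; have [o e] := leafE m.
have : p (g (odd_leaf m)) != p (g (even_leaf m)).
  apply: neq; apply/orP; left; rewrite /star_arc o e /= odd_double eqxx /=.
  by have := ltn_ord m; lia.
have zo : p (g z) != p (g (odd_leaf m)).
  by apply/neq/adjz; rewrite -val_eqE /= o.
have ze : p (g z) != p (g (even_leaf m)).
  by apply/neq/adjz; rewrite -val_eqE /= e.
(* There are only three nonzero values. The centre and the odd leaf have different classes, neither
   of them [k], so the even leaf has class [k]. *)
move: (p_neq0 (g z)) (p_neq0 (g (odd_leaf m))) (p_neq0 (g (even_leaf m))).
move: zo ze odd'k k'z k'0; rewrite -!val_eqE /=.
move: (p (g z)) (p (g (odd_leaf m))) (p (g (even_leaf m))).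
move=> [a la] [b lb] [c lc] /=.
move: (ltn_ord k) la lb lc; clear; lia.
Qed.

End ClassColoring.

(** * Extremal colourings and the exact values *)

Lemma card_ord_interval n lo hi :
  hi <= n -> #|[set x : 'I_n | lo <= x < hi]| = hi - lo.
Proof.
move=> le_hi; rewrite -sum1dep_card -(big_mkord (fun i => lo <= i < hi) (fun _ => 1)).
rewrite -big_nat_widen // -(big_nat_widenl lo 0 hi xpredT) //.
by rewrite sum_nat_const_nat muln1.
Qed.

(** A bound [M < N] would also apply to colourings on [N.-1] vertices, such as [c]. *)
Lemma is_gallai_ramsey_pred k (G H : sgraph) N (c : {set complete N.-1} -> 'I_k) :
    gallai_ramsey_bound k G H N -> exact_coloring c ->
    ~ rainbow_copy c G -> ~ mono_copy c H ->
  is_gallai_ramsey k G H N.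
Proof.
move=> boundN c_exact no_rb no_mono; split=> // M [_ boundM].
rewrite leqNgt; apply/negP=> lt_MN.
by case: (boundM N.-1 _ c c_exact) => //; lia.
Qed.

Lemma gallai_ramsey_bound_star r s N :
    3 <= r < s -> 3 * s <= N + 2 -> 2 * s + 2 * r <= N + 2 ->
  gallai_ramsey_bound 4 (path_graph 5) (star_triangles s.*2 r) N.
Proof.
move=> r_s N1 N2; split=> [|n le_Nn c c_exact].
  by apply: (@leq_trans 'C(4, 2)) => //; apply: leq_bin2l; lia.
pose f (x y : complete n) := c [set x; y].
pose P5 (q : 5.-tuple (complete n)) := uniq q && uniq (pairmap f (thead q) (behead q)).
case: (boolP [exists q, P5 q]) => [/existsP[q /andP[Uq Uf]]|noP5]; [left|right].
  apply: (@rainbow_copy_path n c (thead q) (behead q)) => //.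
    by rewrite size_behead size_tuple.
  by rewrite [q]tuple_eta in Uq.
apply: mono_copy_star; first by lia.
apply: free_coloring_mono_star; rewrite ?card_ord //; try lia.
- by move=> x y; rewrite /f setUC.
- move=> x q sz_q Uq; apply: contra noP5 => Uf.
  have sz_xq : size (x :: q) == 5 by rewrite /= sz_q.
  by apply/existsP; exists (Tuple sz_xq); rewrite /P5 Uq.
move=> h; have [e /imsetP[[x y]]] := c_exact h.
by rewrite inE /= => xy -> <-; exists x, y.
Qed.

(** Each class has two vertices, so its colour occurs. A centre in the first class has only [b + d]
    possible leaves; a centre in another class is excluded by its degree or by a class with fewer
    than [r] vertices. *)
Lemma class_sizes_coloring (a b d r t : nat) :
    1 < a < t -> 1 < b < t -> 1 < d < t -> r.*2 < t -> b + d < t.-1 ->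
    (a + b < t.-1) && (a + d < t.-1) || (b < r) && (d < r) ->
  exists c : {set complete (a + b + d)} -> 'I_4,
    [/\ exact_coloring c, ~ rainbow_copy c (path_graph 5) &
        ~ mono_copy c (star_triangles t r)].
Proof.
move=> at_ bt dt rt bd deg; pose n := a + b + d.
pose col (x : nat) := if x < a then 1 else if x < a + b then 2 else 3.
pose p (x : complete n) : 'I_4 := inord (col x).
have pE x : p x = col x :> nat by rewrite inordK // /col; do 2?case: ifP.
have p'0 x : p x != ord0 by rewrite -val_eqE /= pE /col; do 2?case: ifP.
exists (class_coloring p); split.
- apply: class_coloring_exact => h h'0.
  have inh (i j : nat) : i < j < n -> col i = h -> col j = h ->
      exists x y, [/\ x != y, p x = h & p y = h].
    move=> ij ci cj; have lt_i : i < n by lia.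
    have lt_j : j < n by lia.
    exists (Ordinal lt_i), (Ordinal lt_j); split.
    - by rewrite -val_eqE /=; lia.
    - by apply/val_inj; rewrite /= pE.
    by apply/val_inj; rewrite /= pE.
  case: h h'0 inh => [[|[|[|[|h]]]] lt_h] // _ inh.
  - by apply: (inh 0 1); rewrite /n /col /=; do 2?case: ifP; lia.
  - by apply: (inh a a.+1); rewrite /n /col /=; do 2?case: ifP; lia.
  - by apply: (inh (a + b) (a + b).+1); rewrite /n /col /=; do 2?case: ifP; lia.
- exact: class_coloring_no_rainbow.
have clsE (h : 'I_4) lo hi : hi <= n ->
    (forall x, x < n -> (col x == h) = (lo <= x < hi)) ->
    #|[set x | p x == h]| = hi - lo.
  move=> le_hi colE; rewrite -(card_ord_interval lo le_hi).
  by apply: eq_card => x; rewrite !inE -colE // -val_eqE /= pE.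
have cls (h : 'I_4) : #|[set x | p x == h]| = nth 0 [:: 0; a; b; d] h.
  case: h => [[|[|[|[|h]]]] lt_h] //=.
  - by rewrite (@clsE _ 0 0) // => x _; rewrite /col; do 2?case: ifP.
  - rewrite (@clsE _ 0 a) ?subn0 // => [|x _]; first by rewrite /n; lia.
    by rewrite /col /=; do 2?case: ifP; lia.
  - rewrite (@clsE _ a (a + b)) ?addKn // => [|x _]; first by rewrite /n; lia.
    by rewrite /col /=; do 2?case: ifP; lia.
  - rewrite (@clsE _ (a + b) n) ?addKn // => x lt_x.
    by rewrite /col /= lt_x; do 2?case: ifP; lia.
have cls' (h : 'I_4) : #|[set x | p x != h]| = n - nth 0 [:: 0; a; b; d] h.
  have -> : [set x | p x != h] = ~: [set x | p x == h].
    by apply/setP=> x; rewrite !inE.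
  by have := cardsC [set x | p x == h]; rewrite cls card_ord /n; lia.
apply: class_coloring_no_mono => //; first by lia.
  by move=> h; rewrite cls; move: h => [[|[|[|[|h]]]] lt_h] //=; lia.
move=> h h'0; rewrite cls'; case/orP: deg => [/andP[ab ad]|/andP[lt_br lt_dr]].
  by left; case: h h'0 => [[|[|[|[|h]]]] lt_h] // _; rewrite /n /=; lia.
case: h h'0 => [[|[|[|[|h]]]] lt_h] // _.
- by left; rewrite /n /=; lia.
- by right; exists ord_max; rewrite cls.
by right; exists (inord 2); rewrite cls -!val_eqE /= !inordK.
Qed.

Theorem theorem3p5 (r t : nat) (hr : 3 <= r) (ht : ~~ odd t) :
  (3 <= r <= t %/ 4 ->
     is_gallai_ramsey 4 (path_graph 5) (star_triangles t r) ((3 * t - 4) %/ 2))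
  /\
  ((t + 3) %/ 4 <= r <= (t - 2) %/ 2 ->
     is_gallai_ramsey 4 (path_graph 5) (star_triangles t r) (t + 2 * r - 2)).
Proof.
have [s ->] : exists s, t = s.*2 by exists t./2; move: ht; lia.
split=> /andP[r_ge r_le].
  (* Any two classes have [2 * s - 2] vertices together, one less than the number of leaves. *)
  have [||||||c [c_exact no_rb no_mono]] :=
    @class_sizes_coloring s.-1 s.-1 s.-1 r s.*2; try lia.
  have eN : s.-1 + s.-1 + s.-1 = ((3 * s.*2 - 4) %/ 2).-1 by lia.
  rewrite eN in c c_exact no_rb no_mono.
  apply: is_gallai_ramsey_pred c_exact no_rb no_mono.
  by apply: gallai_ramsey_bound_star; lia.
(* The first class misses a clique of order [t] by one vertex, and each other class is one vertex
   short of meeting [r] triangles; [3 <= r] gives these classes two vertices. *)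
have [||||||c [c_exact no_rb no_mono]] :=
  @class_sizes_coloring s.*2.-1 r.-1 r.-1 r s.*2; try lia.
have eN : s.*2.-1 + r.-1 + r.-1 = (s.*2 + 2 * r - 2).-1 by lia.
rewrite eN in c c_exact no_rb no_mono.
apply: is_gallai_ramsey_pred c_exact no_rb no_mono.
by apply: gallai_ramsey_bound_star; lia.
Qed.
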